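(* Let $m$ be a positive integer. For each polytope $P\subseteq\mathbb{R}^2$ with $v^{(\Phi_{I_2(m)})}\in P$ for each vertex $v$ of $P$ that admits an extended formulation with $n'$ variables and $f'$ inequalities, there is an extended formulation of $\Pi_{I_2(m)}(P)$ with $n'+\lceil\log(m)\rceil+1$ variables and $f'+2\lceil\log(m)\rceil+2$ inequalities.
   Context: $\log$ denotes the logarithm to base $2$. For $\varphi\in\mathbb{R}$ let $H_\varphi=\{x\in\mathbb{R}^2: -x_1\sin\varphi+x_2\cos\varphi=0\}$ and $H_\varphi^{\le}=\{x\in\mathbb{R}^2:-x_1\sin\varphi+x_2\cos\varphi\le 0\}$. The group $I_2(m)$ is the finite group of linear maps of $\mathbb{R}^2$ generated by the orthogonal reflections at $H_0$ and $H_{\pi/m}$; it consists of all reflections at $H_{k\pi/m}$ ($k\in\mathbb{Z}$) and all rotations around the origin by angles $2k\pi/m$ ($k\in\mathbb{Z}$). Its chosen fundamental domain is $\Phi_{I_2(m)}=\{x\in\mathbb{R}^2:x_2\ge 0,\ x\in H^{\le}_{\pi/m}\}$. For $x\in\mathbb{R}^2$, $x^{(\Phi_{I_2(m)})}$ denotes the unique point of $\Phi_{I_2(m)}$ in the orbit of $x$ under $I_2(m)$. For a finite group $G$ of linear maps, $\Pi_G(P)=\operatorname{conv}\bigcup_{g\in G}g(P)$. An extended formulation of a polyhedron $P\subseteq\mathbb{R}^n$ with $d$ variables and $f$ inequalities is a description, by $f$ linear inequalities and arbitrarily many linear equations (which are not counted), of a polyhedron $Q\subseteq\mathbb{R}^d$,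 together with a linear map $\pi:\mathbb{R}^d\to\mathbb{R}^n$ with $\pi(Q)=P$. *)

(* Defs.v *)
From mathcomp Require Import all_boot all_order all_algebra.
From mathcomp Require Import all_classical all_reals all_analysis.

Set Implicit Arguments.
Unset Strict Implicit.
Unset Printing Implicit Defensive.

Import Order.TTheory GRing.Theory Num.Theory.
Local Open Scope classical_set_scope.
Local Open Scope ring_scope.

(* Points of R^n are column vectors, and linear maps are matrices acting on
   them by left multiplication. *)

Section Polyhedra.
Context {R : realType}.

Definition conv_hull (n : nat) (A : set 'cV[R]_n) : set 'cV[R]_n :=
  smallest (@convex_set R 'cV[R]_n) A.

Definition polytope (n : nat) (P : set 'cV[R]_n) : Prop :=
  exists2 V : set 'cV[R]_n, finite_set V & P = conv_hull V.

(* Vertices are the points whose singleton is a face: the intersection of P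
   with the boundary {x | a x = b} of a valid inequality a x <= b. *)
Definition vertex (n : nat) (P : set 'cV[R]_n) (v : 'cV[R]_n) : Prop :=
  exists (a : 'rV[R]_n) (b : R),
    (forall x, P x -> (a *m x) 0 0 <= b) /\
    P `&` [set x | (a *m x) 0 0 = b] = [set v].

Definition polyhedron_of (d f e : nat) (A : 'M[R]_(f, d)) (b : 'cV[R]_f)
    (C : 'M[R]_(e, d)) (c : 'cV[R]_e) : set 'cV[R]_d :=
  [set y | (forall i, (A *m y) i 0 <= b i 0) /\ C *m y = c].

Definition has_extended_formulation (n : nat) (P : set 'cV[R]_n)
    (d f : nat) : Prop :=
  exists (A : 'M[R]_(f, d)) (b : 'cV[R]_f)
    (e : nat) (C : 'M[R]_(e, d)) (c : 'cV[R]_e) (p : 'M[R]_(n, d)),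
    mulmx p @` polyhedron_of A b C c = P.

End Polyhedra.

Section LinearGroups.
Context {R : realType}.

Definition is_linear_group (n : nat) (G : set 'M[R]_n) : Prop :=
  [/\ G `<=` [set g | g \in unitmx],
      G 1%:M,
      forall g h, G g -> G h -> G (g *m h)
    & forall g, G g -> G (invmx g)].

Definition generated_linear_group (n : nat) (S : set 'M[R]_n) :
    set 'M[R]_n :=
  smallest (@is_linear_group n) S.

Definition linear_orbit (n : nat) (G : set 'M[R]_n) (x : 'cV[R]_n) :
    set 'cV[R]_n :=
  [set g *m x | g in G].

(* Meaningful when D meets each G-orbit in exactly one point; then the default
   value 0 is not used. *)
Definition orbit_representative (n : nat) (G : set 'M[R]_n)
    (D : set 'cV[R]_n) (x : 'cV[R]_n) : 'cV[R]_n :=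
  xget 0 (linear_orbit G x `&` D).

Definition symmetrized_hull (n : nat) (G : set 'M[R]_n)
    (P : set 'cV[R]_n) : set 'cV[R]_n :=
  conv_hull (\bigcup_(g in G) (mulmx g @` P)).

End LinearGroups.

Section Dihedral.
Context {R : realType}.

Definition line_form (phi : R) (x : 'cV[R]_2) : R :=
  - x 0 0 * sin phi + x 1 0 * cos phi.

Definition line (phi : R) : set 'cV[R]_2 := [set x | line_form phi x = 0].

Definition halfplane (phi : R) : set 'cV[R]_2 :=
  [set x | line_form phi x <= 0].

(* Unit normal vector (- sin phi, cos phi) of line phi. *)
Definition line_normal (phi : R) : 'cV[R]_2 :=
  \col_(i < 2) (if i == 0 then - sin phi else cos phi).

Definition reflection (phi : R) : 'M[R]_2 :=
  1%:M - 2 *: (line_normal phi *m (line_normal phi)^T).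

Lemma reflectionE (phi : R) (x : 'cV[R]_2) :
  reflection phi *m x = x - (2 * line_form phi x) *: line_normal phi.
Proof.
rewrite /reflection mulmxBl mul1mx -scalemxAl -mulmxA -scalerA.
congr (_ - _ *: _); rewrite (mx11_scalar (_^T *m x)) mul_mx_scalar.
by rewrite /line_form !mxE 2!big_ord_recr big_ord0 /= !mxE /= add0r mulrC mulrN
  mulNr [cos _ * _]mulrC; congr ((- (_ * _) + _ * _) *: _);
  congr (x _ _); apply/val_inj.
Qed.

Lemma reflection_id (phi : R) (x : 'cV[R]_2) :
  line phi x -> reflection phi *m x = x.
Proof. by move=> xH; rewrite reflectionE xH mulr0 scale0r subr0. Qed.

Lemma reflection_normal (phi : R) :
  reflection phi *m line_normal phi = - line_normal phi.
Proof.
rewrite reflectionE /line_form !mxE /= opprK -!expr2 [sin _ ^+ 2 + _]addrC cos2Dsin2 mulr1.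
by rewrite scaler_nat mulr2n opprD addrA subrr add0r.
Qed.

Definition I2 (m : nat) : set 'M[R]_2 :=
  generated_linear_group [set reflection 0; reflection (pi / m%:R)].

Definition I2_domain (m : nat) : set 'cV[R]_2 :=
  [set x : 'cV[R]_2 | 0 <= x 1 0] `&` halfplane (pi / m%:R).

(* For m > 0 the logarithm is nonnegative, so the absolute value only casts
   the ceiling from int to nat. *)
Definition ceil_log2 (m : nat) : nat :=
  `|Num.ceil (ln (m%:R : R) / ln 2)|%N.

End Dihedral.

Arguments I2 R m : clear implicits.
Arguments I2_domain R m : clear implicits.
Arguments ceil_log2 R m : clear implicits.

(* Main.v *)
(* Following Kaibel and Pashkovich: replacing a set Q by the union of the
   segments [x, s x], where s is the reflection at a line and x runs over the
   points of Q on one side of it, costs one variable (the position on the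
   segment) and two inequalities.  With r = ceil(log m), apply this to P for the
   lines of angles pi/m, 2 pi/m, ..., 2^(r-1) pi/m and finally for the x-axis.
   The result is convex and contained in the symmetrized hull.  It contains g v
   for every vertex v of P and g in I_2(m): fold g v into the upper half plane
   and then, halving the admissible sector at each step, into the fundamental
   domain; this yields the representative of v, which lies in P, and undoing the
   folds stays inside the relations. *)
Require Import Defs.
From mathcomp Require Import all_boot all_order all_algebra.
From mathcomp Require Import all_classical all_reals all_analysis.
From mathcomp Require Import ring lra.

Set Implicit Arguments.
Unset Strict Implicit.
Unset Printing Implicit Defensive.

Import Order.TTheory GRing.Theory Num.Theory.
Local Open Scope classical_set_scope.
Local Open Scope ring_scope.

(** * Convex sets and convex hulls *)

Section Convexity.
Variable R : realType.

Lemma convex_setP (V : lmodType R) (A : set V) :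
  convex_set A <-> forall x y t, A x -> A y -> 0 <= t -> t <= 1 ->
    A (t *: x + (1 - t) *: y).
Proof.
split=> [cA x y t Ax Ay t0 t1|cA x y t /set_mem Ax /set_mem Ay]; last first.
  by apply/mem_set/cA.
by have /set_mem := cA x y (Itv01 t0 t1) (mem_set Ax) (mem_set Ay).
Qed.

Lemma sub_conv_hull (n : nat) (A : set 'cV[R]_n) : A `<=` conv_hull A.
Proof. exact: sub_smallest. Qed.

Lemma conv_hull_min (n : nat) (A B : set 'cV[R]_n) :
  convex_set B -> A `<=` B -> conv_hull A `<=` B.
Proof. exact: smallest_sub. Qed.

Lemma convex_conv_hull (n : nat) (A : set 'cV[R]_n) : convex_set (conv_hull A).
Proof.
apply/convex_setP => x y t Ax Ay t0 t1 B [cB AB].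
by apply: (convex_setP B).1 => //; [apply: Ax|apply: Ay].
Qed.

Lemma convex_preimage (n : nat) (g : 'M[R]_n) (A : set 'cV[R]_n) :
  convex_set A -> convex_set (mulmx g @^-1` A).
Proof.
move=> /convex_setP cA; apply/convex_setP => x y t /= Ax Ay t0 t1.
by rewrite mulmxDr -!scalemxAr; apply: cA.
Qed.

End Convexity.

(** * Every polytope lies in the convex hull of its vertices *)

Section Vertices.
Variable R : realType.

Definition ev (n : nat) (a : 'rV[R]_n) (x : 'cV[R]_n) : R := (a *m x) 0 0.

Lemma evDl n (a b : 'rV[R]_n) x : ev (a + b) x = ev a x + ev b x.
Proof. by rewrite /ev mulmxDl mxE. Qed.

Lemma evZl n k (a : 'rV[R]_n) x : ev (k *: a) x = k * ev a x.
Proof. by rewrite /ev -scalemxAl mxE. Qed.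

Lemma evDr n (a : 'rV[R]_n) x y : ev a (x + y) = ev a x + ev a y.
Proof. by rewrite /ev mulmxDr mxE. Qed.

Lemma evZr n k (a : 'rV[R]_n) x : ev a (k *: x) = k * ev a x.
Proof. by rewrite /ev -scalemxAr mxE. Qed.

Lemma evNl n (a : 'rV[R]_n) x : ev (- a) x = - ev a x.
Proof. by rewrite /ev mulNmx mxE. Qed.

Lemma evBr n (a : 'rV[R]_n) x y : ev a (x - y) = ev a x - ev a y.
Proof. by rewrite /ev mulmxBr !mxE. Qed.

Definition evE := (evBr, evDl, evZl, evDr, evZr, evNl).

Lemma ev_trmx_gt0 n (x : 'cV[R]_n) : x != 0 -> 0 < ev x^T x.
Proof.
move=> x0; rewrite lt_def andbC /ev mxE; apply/andP; split.
  by apply: sumr_ge0 => i _; rewrite mxE -expr2 sqr_ge0.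
apply: contra x0 => /eqP s0; apply/eqP/colP => i; rewrite [RHS]mxE.
apply/eqP; rewrite -sqrf_eq0 expr2; apply/eqP.
have := @psumr_eq0P _ _ xpredT (fun j => x^T 0 j * x j 0) _ s0 i isT.
by rewrite mxE; apply => j _; rewrite mxE -expr2 sqr_ge0.
Qed.

(** Finitely many strict inequalities survive a small perturbation; the summand 1 in
    [g x / (1 + |f x|)] guards against [f x = 0]. *)
Lemma exists_small_pos (T : eqType) (s : seq T) (f g : T -> R) :
  (forall x, x \in s -> 0 < g x) ->
  exists2 e : R, 0 < e & forall x, x \in s -> e * `|f x| < g x.
Proof.
elim: s => [|x s IHs] gs; first by exists 1.
have [y ys|e e0 es] := IHs; first by rewrite gs// inE ys orbT.
have gx : 0 < g x by rewrite gs ?mem_head.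
have d0 : 0 < 1 + `|f x| by rewrite ltr_pwDl.
exists (Num.min e (g x / (1 + `|f x|))) => [|y]; first by rewrite lt_min e0 divr_gt0.
rewrite inE => /predU1P[->|ys].
  apply: (@le_lt_trans _ _ (g x / (1 + `|f x|) * `|f x|)).
    by rewrite ler_wpM2r ?normr_ge0// ge_min lexx orbT.
  by rewrite -mulrA gtr_pMr// mulrC ltr_pdivrMr// mul1r ltrDr.
apply: le_lt_trans (es y ys).
by rewrite ler_wpM2r ?normr_ge0// ge_min lexx.
Qed.

(* Gordan's theorem of the alternative, by elimination of one vector at a time:
   if a is positive on s but not on w, a functional b positive on the vectors
   (a x) w - (a w) x of the hyperplane a = 0 is perturbed along a. *)
Lemma gordan (n : nat) (K : set 'cV[R]_n) (s : seq 'cV[R]_n) :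
  (forall x y, K x -> K y -> K (x + y)) ->
  (forall k x, 0 < k -> K x -> K (k *: x)) -> ~ K 0 ->
  (forall x, x \in s -> K x) ->
  exists a : 'rV[R]_n, forall x, x \in s -> 0 < ev a x.
Proof.
move=> KD KZ K0; move: {2}(size s) (erefl (size s)) => k.
elim: k s => [|k IHk] [|w s]//=; first by exists 0.
move=> [sk] Ks; have Kw : K w by apply: Ks; exact: mem_head.
have Ks' x : x \in s -> K x by move=> xs; apply: Ks; rewrite inE xs orbT.
have [a sa] := IHk s sk Ks'.
have [aw|aw] := ltP 0 (ev a w).
  by exists a => x; rewrite inE => /predU1P[->//|/sa].
pose u x := ev a x *: w - ev a w *: x.
have [|x /mapP[y ys ->]|b sb] := IHk (map u s).
- by rewrite size_map.
- rewrite /u; have [->|aw0] := eqVneq (ev a w) 0.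
    by rewrite scale0r subr0; apply: KZ (sa _ ys) _.
  rewrite -scaleNr; apply: KD; first exact: KZ (sa _ ys) _.
  by apply: KZ (Ks' _ ys); rewrite oppr_gt0 lt_def eq_sym aw0.
have {}sb x : x \in s -> 0 < ev a x * ev b w - ev a w * ev b x.
  by move=> xs; have := sb _ (map_f u xs); rewrite /u !evE.
(* If [a w = 0], positivity of [b] on [(a y) w] forces [b w > 0], so [a + e b] works for small [e].
   With [s] empty there is no such [y], and [w^T] serves because [w] is nonzero. *)
have [aw0|aw0] := eqVneq (ev a w) 0.
  case: s => [|y s] in sk Ks Ks' sa sb *.
    exists w^T => x; rewrite inE => /eqP ->; apply: ev_trmx_gt0.
    by apply/eqP => w0; rewrite w0 in Kw.
  have bw : 0 < ev b w.
    have /sb := mem_head y s; rewrite aw0 mul0r subr0 pmulr_rgt0//.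
    by rewrite sa ?mem_head.
  have [e e0 es] := exists_small_pos (ev b) sa.
  exists (a + e *: b) => x; rewrite inE !evE => /predU1P[->|xs].
    by rewrite aw0 add0r mulr_gt0.
  have := es _ xs; have := ler_norm (- ev b x); rewrite normrN.
  rewrite -(ler_pM2l e0); lra.
have {}aw : ev a w < 0 by rewrite lt_neqAle aw0.
(* With [e = 0] the functional below would vanish at [w]; subtracting [e a] makes its value there
   [- e (a w) > 0], and a small [e] keeps it positive on [s]. *)
have [e e0 es] := exists_small_pos (ev a) sb.
exists ((ev b w - e) *: a - ev a w *: b) => x.
rewrite inE !evE => /predU1P[->|xs].
  suff: 0 < - (e * ev a w) by lra.
  by rewrite oppr_gt0 pmulr_rlt0.
have := es _ xs; have := ler_norm (ev a x); rewrite -(ler_pM2l e0); lra.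
Qed.

(** The cone [K] spanned by the differences [x - v], for [x] in the hull of [s], misses 0 because
    [v] is outside that hull. Gordan's theorem then yields a functional whose unique minimizer on
    the hull of [V] is [v]. *)
Lemma exposed_vertex (n : nat) (V : set 'cV[R]_n) (s : seq 'cV[R]_n) v :
  V v -> (forall x, V x -> x = v \/ x \in s) -> ~ conv_hull [set` s] v ->
  vertex (conv_hull V) v.
Proof.
move=> Vv Vs sv.
have cs := (convex_setP _).1 (@convex_conv_hull _ _ [set` s]).
pose K := [set z : 'cV[R]_n | exists k x,
  [/\ 0 < k, conv_hull [set` s] x & z = k *: (x - v)]].
have [_ _ [k [x [k0 sx ->]]] [l [y [l0 sy ->]]]||[k [x [k0 sx kx0]]]||a sa] :=
  @gordan n K [seq x - v | x <- s].
- have kl : 0 < k + l by rewrite addr_gt0.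
  exists (k + l), ((k / (k + l)) *: x + (1 - k / (k + l)) *: y); split=> //.
    by apply: cs; rewrite ?divr_ge0 ?ltW// ltr_pdivrMr// mul1r ltrDl.
  rewrite !scalerBr scalerDr !scalerA mulrCA divff ?gt_eqF// mulr1.
  rewrite mulrBr mulr1 mulrCA divff ?gt_eqF// mulr1 [k + l - k]addrAC subrr add0r.
  by rewrite scalerDl opprD addrACA.
- move=> k _ k0 [l [x [l0 sx ->]]]; exists (k * l), x.
  by rewrite mulr_gt0// scalerA.
- move/esym/eqP: kx0; rewrite scaler_eq0 gt_eqF//= subr_eq0 => /eqP xv.
  by apply: sv; rewrite -xv.
- move=> _ /mapP[x xs ->]; exists 1, x; rewrite scale1r; split=> //.
  exact: sub_conv_hull.
(* The point [v] together with the open half-space [a x > a v] is a convex set containing [V]. *)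
have Pv x : conv_hull V x -> x = v \/ ev a v < ev a x.
  apply: (@smallest_sub _ _ _ [set x | x = v \/ ev a v < ev a x]).
    apply/convex_setP => {}x y t /= hx hy t0 t1.
    have [->|t0'] := eqVneq t 0; first by rewrite scale0r add0r subr0 scale1r.
    have [->|t1'] := eqVneq t 1; first by rewrite subrr scale0r addr0 scale1r.
    have {t0 t0'}t0 : 0 < t by rewrite lt_def t0'.
    have {t1 t1'}t1 : 0 < 1 - t by rewrite subr_gt0 lt_neqAle t1'.
    have [ltl ltr] := (ltr_pM2l t0, ltr_pM2l t1).
    case: hx hy => [->|hx] [->|hy].
    - by left; rewrite -scalerDl addrC subrK scale1r.
    - right; rewrite !evE; move: hy; rewrite -ltr; lra.
    - right; rewrite !evE; move: hx; rewrite -ltl; lra.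
    - right; rewrite !evE; move: hx hy; rewrite -ltl -[_ < ev a y]ltr; lra.
  move=> {}x /Vs[->|xs]; [by left|right].
  by have := sa _ (map_f (fun x => x - v) xs); rewrite evE subr_gt0.
exists (- a), (- ev a v); split=> [x /Pv[->|ax]|].
- by rewrite -/(ev _ _) evE.
- by rewrite -/(ev _ _) evE lerN2 ltW.
apply/seteqP; split=> [x [/Pv[//|ax]]|_ ->] /=; rewrite -/(ev _ _) evE.
  by move/oppr_inj => xv; rewrite xv ltxx in ax.
by split=> //; exact: sub_conv_hull.
Qed.

Lemma conv_hull_mem_sub (n : nat) (V W : set 'cV[R]_n) :
  V `<=` conv_hull W -> conv_hull V `<=` conv_hull W.
Proof. by apply: conv_hull_min; exact: convex_conv_hull. Qed.

Lemma polytope_sub_conv_vertices (n : nat) (P : set 'cV[R]_n) :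
  polytope P -> P `<=` conv_hull (vertex P).
Proof.
move=> [V /finite_seqP[s ->] ->] {P V}.
move: {2}(size s).+1 (ltnSn (size s)) => k.
elim: k s => // k IHk s sk.
have [[v vs svv]|hs] := pselect (exists2 v, v \in s &
    conv_hull [set` [seq x <- s | x != v]] v).
  set t := [seq x <- s | x != v] in svv.
  have ts : (size t < k)%N.
    rewrite size_filter; apply: leq_trans (sk : (size s <= k)%N); rewrite -(count_predC (predC1 v) s).
    by rewrite -addn1 leq_add2l -has_count; apply/hasP; exists v => //=; rewrite negbK.
  suff -> : conv_hull [set` s] = conv_hull [set` t] by exact: IHk.
  apply/seteqP; split; apply: conv_hull_mem_sub => x /=.
    by have [->//|xv xs] := eqVneq x v; apply: sub_conv_hull; rewrite /= mem_filter xv.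
  by rewrite mem_filter => /andP[_ xs]; exact: sub_conv_hull.
apply: conv_hull_mem_sub => v /= vs; apply: sub_conv_hull.
apply: (exposed_vertex vs (s := [seq x <- s | x != v])) => [x /= xs|svv].
  by have [|xv] := eqVneq x v; [left|right; rewrite mem_filter xv].
by apply: hs; exists v.
Qed.

End Vertices.

(** * Extended formulations and the cost of a reflection relation *)

Section ExtendedFormulations.
Variable R : realType.

(** Gives convexity of the iterated reflection relations for free, as they are projections of
    polyhedra. *)
Lemma convex_extended_formulation (n d f : nat) (P : set 'cV[R]_n) :
  has_extended_formulation P d f -> convex_set P.
Proof.
move=> [A [b [e [C [c [p <-]]]]]].
apply/convex_setP => _ _ t [y [Ay Cy] <-] [z [Az Cz] <-] t0 t1.
exists (t *: y + (1 - t) *: z); last by rewrite mulmxDr -!scalemxAr.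
have {}t1 : 0 <= 1 - t by rewrite subr_ge0.
split=> [i|]; rewrite mulmxDr -!scalemxAr; last first.
  by rewrite Cy Cz -scalerDl addrC subrK scale1r.
rewrite mxE [X in X + _]mxE [X in _ + X]mxE; have -> : b i 0 = t * b i 0 + (1 - t) * b i 0 by ring.
by apply: lerD; apply: ler_wpM2l.
Qed.

(* The union of the segments [x, x - 2 (a x) u] over the points x of Q with
   a x <= 0; for a = u^T and u a unit vector, x - 2 (a x) u is the mirror image
   of x in the hyperplane a x = 0. *)
Definition reflection_relation (n : nat) (a : 'rV[R]_n) (u : 'cV[R]_n)
    (Q : set 'cV[R]_n) : set 'cV[R]_n :=
  [set y | exists x t, [/\ Q x, 0 <= t, t <= - (2 * ev a x) & y = x + t *: u]].

Lemma forall_col_mx_le (k l : nat) (A b : 'cV[R]_k) (B c : 'cV[R]_l) :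
  (forall i, col_mx A B i 0 <= col_mx b c i 0) <->
  (forall i, A i 0 <= b i 0) /\ (forall i, B i 0 <= c i 0).
Proof.
split=> [h|[hA hB] i].
  by split=> i; [have := h (lshift _ i)|have := h (rshift _ i)];
    rewrite ?col_mxEu ?col_mxEd.
by case: (split_ordP i) => j ->; rewrite ?col_mxEu ?col_mxEd.
Qed.

Lemma extended_formulation_reflection_relation (n d f : nat) (a : 'rV[R]_n) u
    (Q : set 'cV[R]_n) :
  has_extended_formulation Q d f ->
  has_extended_formulation (reflection_relation a u Q) (d + 1) (f + 2).
Proof.
move=> [A [b [e [C [c [p <-]]]]]].
(* The new last coordinate is the position [t]; the two rows say [- t <= 0] and
   [2 a (p y) + t <= 0]. The projection [row_mx p u] sends [(y, t)] to [p y + t u]. *)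
pose B : 'M[R]_(1 + 1, d + 1) := col_mx (row_mx 0 (- 1%:M))
  (row_mx (2 *: (a *m p)) 1%:M).
exists (col_mx (row_mx A 0) B), (col_mx b 0), e, (row_mx C 0), c, (row_mx p u).
have polyE y t : polyhedron_of (col_mx (row_mx A 0) B) (col_mx b 0) (row_mx C 0) c
    (col_mx y t%:M) <->
    [/\ polyhedron_of A b C c y, 0 <= t & t <= - (2 * ev a (p *m y))].
  rewrite /polyhedron_of /= mul_col_mx !mul_row_col !mul0mx !addr0.
  rewrite forall_col_mx_le mul_col_mx -(@col_mx0 _ 1 1) forall_col_mx_le.
  rewrite !mul_row_col !mul0mx add0r mulNmx !mul1mx.
  have -> : (forall i, (- t%:M) i 0 <= (0 : 'cV[R]_1) i 0) <-> 0 <= t.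
    split=> [/(_ 0)|h i]; rewrite ?ord1 !mxE mulr1n ?oppr_le0//.
  have -> : (forall i, ((2 *: (a *m p)) *m y + t%:M) i 0 <= (0 : 'cV[R]_1) i 0) <->
      t <= - (2 * ev a (p *m y)).
    rewrite -scalemxAl -mulmxA /ev; split=> [/(_ 0)|h i]; rewrite ?ord1;
      rewrite [X in X <= _]mxE [X in X + _]mxE [t%:M _ _]mxE [X in _ <= X]mxE mulr1n; lra.
  by split=> [[[? [? ?]] ?]|[[? ?] ? ?]].
apply/seteqP; split=> [_ [z + <-]|_ [_ [t [[y Py <-] t0 ty ->]]]] /=.
  rewrite -[z]vsubmxK [dsubmx z]mx11_scalar; set t := dsubmx z 0 0.
  move=> /polyE[Py t0 ty]; exists (p *m usubmx z), t; split=> //.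
  by rewrite mul_row_col mul_mx_scalar.
by exists (col_mx y t%:M); [exact/polyE|rewrite mul_row_col mul_mx_scalar].
Qed.

End ExtendedFormulations.

(** * Polar coordinates, in which reflections act on angles *)

Section PolarCoordinates.
Variable R : realType.
Implicit Types (r s theta tau phi : R) (x y z : 'cV[R]_2).

Definition polar r theta : 'cV[R]_2 :=
  \col_(i < 2) (if i == 0 then r * cos theta else r * sin theta).

Lemma polar0E r theta : polar r theta 0 0 = r * cos theta.
Proof. by rewrite mxE. Qed.

Lemma polar1E r theta : polar r theta 1 0 = r * sin theta.
Proof. by rewrite mxE. Qed.

Lemma eq_col2 x y : x 0 0 = y 0 0 -> x 1 0 = y 1 0 -> x = y.
Proof.
by move=> xy0 xy1; apply/colP => -[[|[|//]] i2]; [move: xy0|move: xy1];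
  congr (x _ _ = y _ _); apply: val_inj.
Qed.

Lemma line_form_polar phi r theta :
  line_form phi (polar r theta) = r * sin (theta - phi).
Proof. by rewrite /line_form polar0E polar1E sinB; ring. Qed.

Lemma reflection_polar phi r theta :
  reflection phi *m polar r theta = polar r (phi *+ 2 - theta).
Proof.
have -> : phi *+ 2 - theta = phi - (theta - phi) by rewrite mulr2n; ring.
rewrite reflectionE line_form_polar.
move: (theta - phi) (subrK phi theta) => psi <-.
by apply: eq_col2; rewrite !mxE /= ?sinD ?cosD ?cosN ?sinN; ring.
Qed.

Lemma polar_upper_halfplane x : 0 <= x 1 0 ->
  exists r theta, [/\ 0 <= r, 0 <= theta, theta <= pi & x = polar r theta].
Proof.
move=> x1; pose r := Num.sqrt (x 0 0 ^+ 2 + x 1 0 ^+ 2).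
have r2 : r ^+ 2 = x 0 0 ^+ 2 + x 1 0 ^+ 2 by rewrite sqr_sqrtr// addr_ge0// sqr_ge0.
have [r0|r0] := eqVneq r 0.
  exists 0, 0; rewrite lexx pi_ge0; split=> //.
  move: r2; rewrite r0 expr0n/= => /esym/eqP; rewrite paddr_eq0 ?sqr_ge0// !sqrf_eq0.
  by move=> /andP[/eqP x00 /eqP x10]; apply: eq_col2; rewrite ?polar0E ?polar1E mul0r.
have {r0}r0 : 0 < r by rewrite lt_def r0 sqrtr_ge0.
clearbody r.
have xr : -1 <= x 0 0 / r <= 1.
  rewrite -ler_norml normf_div (gtr0_norm r0) ler_pdivrMr// mul1r.
  by rewrite -(gtr0_norm r0) -ler_sqr ?nnegrE// !real_normK ?num_real// r2 lerDl sqr_ge0.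
exists r, (acos (x 0 0 / r)); split; [exact: ltW|exact: acos_ge0|exact: acos_lepi|].
apply: eq_col2; rewrite ?polar0E ?polar1E.
  by rewrite acosK ?in_itv//= mulrC divfK ?gt_eqF.
(* Both sides are nonnegative, as the point is in the upper half plane, so comparing squares
   suffices. *)
rewrite sin_acos//; apply/eqP; rewrite -(@eqrXn2 _ 2)// ?mulr_ge0 ?sqrtr_ge0 ?ltW//.
rewrite exprMn sqr_sqrtr; last first.
  by case/andP: xr; move: (x 0 0 / r) => t; nra.
have -> : r ^+ 2 * (1 - (x 0 0 / r) ^+ 2) = r ^+ 2 - x 0 0 ^+ 2.
  by field; rewrite gt_eqF.
by rewrite r2 addrC addKr.
Qed.

Lemma polarP x : exists r theta, 0 <= r /\ x = polar r theta.
Proof.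
have [x1|x1] := lerP 0 (x 1 0).
  by have [r [theta [r0 _ _ ->]]] := polar_upper_halfplane x1; exists r, theta.
have [|r [theta [r0 _ _ xE]]] := @polar_upper_halfplane (reflection 0 *m x).
  by rewrite reflectionE /line_form !mxE /= sin0 cos0; lra.
exists r, (- theta); split=> //.
have := reflection_polar 0 r theta; rewrite -xE mul0rn add0r => <-.
by rewrite reflectionE /line_form; apply: eq_col2; rewrite reflectionE /line_form !mxE /= sin0 cos0; ring.
Qed.

Lemma polar_inj r s theta tau : 0 <= r -> 0 <= s ->
  polar r theta = polar s tau ->
  r = s /\ (r = 0 \/ cos theta = cos tau /\ sin theta = sin tau).
Proof.
move=> r0 s0 E; have := congr1 (fun x : 'cV[R]_2 => x 0 0) E.
have := congr1 (fun x : 'cV[R]_2 => x 1 0) E; rewrite /= !polar0E !polar1E.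
move=> sinE cosE; have rs : r = s.
  apply/eqP; rewrite -(@eqrXn2 _ 2)//; apply/eqP.
  rewrite -[LHS]mulr1 -[RHS]mulr1 -{1}(cos2Dsin2 theta) -(cos2Dsin2 tau).
  by rewrite !mulrDr -!exprMn sinE cosE.
split=> //; subst s; have [|rN0] := eqVneq r 0; first by left.
by right; split; apply: (mulfI rN0).
Qed.

(** Reduces identities between products of reflections to arithmetic of angles. *)
Lemma eq_mx_polar (A B : 'M[R]_2) :
  (forall r theta, A *m polar r theta = B *m polar r theta) -> A = B.
Proof.
move=> AB; apply/matrixP => i j; have [r [theta [_ jE]]] := polarP (delta_mx j 0).
by have := AB r theta; rewrite -jE -!colE => /colP/(_ i); rewrite !mxE.
Qed.

(** Makes [cos (m theta)] independent of the angle chosen for a nonzero point; the induction has to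
    carry the sine along. *)
Lemma cos_mulnat_congr (m : nat) theta tau :
  cos theta = cos tau -> sin theta = sin tau ->
  cos (m%:R * theta) = cos (m%:R * tau).
Proof.
move=> ce se; suff [//] : cos (m%:R * theta) = cos (m%:R * tau) /\
  sin (m%:R * theta) = sin (m%:R * tau).
elim: m => [|m [IHc IHs]]; first by rewrite !mul0r.
by rewrite -natr1 !mulrDl !mul1r !cosD !sinD IHc IHs ce se.
Qed.

End PolarCoordinates.

(** * Orbits and fundamental domain of I_2(m) *)

Section DihedralGroup.
Variables (R : realType) (m : nat).
Hypothesis m_gt0 : (0 < m)%N.
Implicit Types (r s theta tau phi : R) (x y z : 'cV[R]_2).

Let m0 : 0 < m%:R :> R. Proof. by rewrite ltr0n. Qed.

(* Complete invariants of the I_2(m)-orbits: the radius and cos (m theta), the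
   angle being irrelevant at the origin. *)
Definition same_invariants x y : Prop :=
  forall r theta s tau, 0 <= r -> 0 <= s -> x = polar r theta -> y = polar s tau ->
  r = s /\ (r = 0 \/ cos (m%:R * theta) = cos (m%:R * tau)).

Lemma same_invariants_refl x : same_invariants x x.
Proof.
move=> r theta s tau r0 s0 -> /(polar_inj r0 s0)[-> [->|[ce se]]].
  by split; [|left].
by split; [|right; exact: cos_mulnat_congr].
Qed.

Lemma same_invariants_sym x y : same_invariants x y -> same_invariants y x.
Proof.
move=> xy r theta s tau r0 s0 yE xE.
by have [-> [->|->]] := xy _ _ _ _ s0 r0 xE yE; split; by [|left|right].
Qed.

Lemma same_invariants_trans x y z :
  same_invariants x y -> same_invariants y z -> same_invariants x z.
Proof.
move=> xy yz r theta s tau r0 s0 xE zE; have [q [eta [q0 yE]]] := polarP y.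
have [rq h] := xy _ _ _ _ r0 q0 xE yE; have [qs h'] := yz _ _ _ _ q0 s0 yE zE.
subst q r; split=> //; case: h => [->|->]; first by left.
by case: h' => [->|->]; [left|right].
Qed.

Lemma same_invariants_reflection phi x :
  (forall t, cos (m%:R * (phi *+ 2 - t)) = cos (m%:R * t)) ->
  same_invariants x (reflection phi *m x).
Proof.
move=> phiP r theta s tau r0 s0 -> /esym; rewrite reflection_polar.
move=> /(polar_inj s0 r0)[-> [->|[ce se]]]; first by split; [|left].
by split; [|right; rewrite -phiP; apply/esym/cos_mulnat_congr].
Qed.

Lemma reflectionK phi : reflection phi *m reflection phi = 1%:M.
Proof.
apply: eq_mx_polar => r theta.
by rewrite mul1mx -mulmxA !reflection_polar opprB addrC subrK.
Qed.

Lemma I2_same_invariants g x : I2 R m g -> same_invariants x (g *m x).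
Proof.
(* [S] is a linear group containing both generators, hence contains the group they generate. *)
pose S := [set g : 'M[R]_2 | g \in unitmx /\ forall x, same_invariants x (g *m x)].
suff IS : I2 R m `<=` S by move=> /IS[].
have gen phi : (forall t, cos (m%:R * (phi *+ 2 - t)) = cos (m%:R * t)) ->
    S (reflection phi).
  split=> [|y]; last exact: same_invariants_reflection.
  by have [] := mulmx1_unit (reflectionK phi).
apply: smallest_sub => [|_ [->|->]].
- split=> [h []//||h k [hu hP] [ku kP]|h [hu hP]].
  + by split=> [|y]; rewrite ?unitmx1// mul1mx; exact: same_invariants_refl.
  + split=> [|y]; first by rewrite unitmx_mul hu.
    by rewrite -mulmxA; apply: same_invariants_trans (kP _) (hP _).
  + split=> [|y]; first by rewrite unitmx_inv.
    by have := hP (invmx h *m y); rewrite mulKVmx// => /same_invariants_sym.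
- by apply: gen => t; rewrite mul0rn add0r mulrN cosN.
(* Here [m (2 pi / m - t) = 2 pi - m t], which has the cosine of [m t]. *)
- apply: gen => t; rewrite mulrBr mulrnAr mulrCA divff ?gt_eqF// mulr1.
  by rewrite -cosN opprB -(cosD2pi (_ - _)) subrK.
Qed.

Lemma I2_1 : I2 R m 1%:M.
Proof. by move=> A [[]]. Qed.

Lemma I2_mul g h : I2 R m g -> I2 R m h -> I2 R m (g *m h).
Proof.
move=> Ig Ih A AS; have [[_ _ AM _] _] := AS.
by apply: AM; [exact: Ig|exact: Ih].
Qed.

Lemma I2_reflection0 : I2 R m (reflection 0).
Proof. by move=> A [_]; apply; left. Qed.

(** The angles 0 and [pi] give the same line, but [halfplane pi] is the upper half plane, the side
    onto which the last fold goes. *)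
Lemma I2_reflection_pi : I2 R m (reflection pi).
Proof.
suff -> : reflection (pi : R) = reflection 0 by exact: I2_reflection0.
apply: eq_mx_polar => r theta; rewrite !reflection_polar mul0rn add0r addrC.
by rewrite /polar cosD2pi sinD2pi.
Qed.

Definition fold_angle (k : nat) : R := 2 ^+ k * (pi / m%:R).

(** Conjugating the reflection at angle 0 by the one at [phi] gives the reflection at [2 phi], so
    doubling angles stays in the group. *)
Lemma I2_fold_angle k : I2 R m (reflection (fold_angle k)).
Proof.
elim: k => [|k IHk]; first by move=> A [_]; apply; right; rewrite /fold_angle mul1r.
suff -> : reflection (fold_angle k.+1) =
    reflection (fold_angle k) *m (reflection 0 *m reflection (fold_angle k)).
  exact: I2_mul (I2_mul I2_reflection0 _).
apply: eq_mx_polar => r theta; rewrite -!mulmxA !reflection_polar.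
by congr polar; rewrite /fold_angle exprS; ring.
Qed.

Lemma I2_domain_polar x : I2_domain R m x ->
  exists r theta, [/\ 0 <= r, 0 <= theta, theta <= pi / m%:R & x = polar r theta].
Proof.
have pm0 : 0 < (pi : R) / m%:R by rewrite divr_gt0 ?pi_gt0.
move=> [/polar_upper_halfplane[r [theta [r0 theta0 theta_pi ->]]]].
rewrite /halfplane /= line_form_polar.
have [->|rN0] := eqVneq r 0.
  exists 0, 0; rewrite lexx ltW//; split=> //.
  by apply: eq_col2; rewrite ?polar0E ?polar1E !mul0r.
rewrite pmulr_rle0 ?lt_def ?rN0//; have [|theta_gt] := leP theta (pi / m%:R).
  by exists r, theta.
(* An angle beyond [pi / m] would put [theta - pi / m] strictly between 0 and [pi], where the sine
   is positive. *)
by rewrite leNgt sin_gt0_pi// subr_gt0 theta_gt ltrBlDr ltr_pwDr.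
Qed.

(** On the domain [m theta] ranges over [[0, pi]], where the cosine is injective, so the invariants
    determine the point. *)
Lemma I2_domain_uniq x y :
  I2_domain R m x -> I2_domain R m y -> same_invariants x y -> x = y.
Proof.
have mtheta (t : R) : 0 <= t -> t <= pi / m%:R -> m%:R * t \in `[0, pi]%R.
  by move=> t0 tm; rewrite in_itv/= (mulr_ge0 (ltW m0))//= mulrC -ler_pdivlMr.
move=> /I2_domain_polar[r [theta [r0 t0 t1 xE]]].
move=> /I2_domain_polar[s [tau [s0 u0 u1 yE]]] /(_ _ _ _ _ r0 s0 xE yE)[rs].
rewrite xE yE -rs => -[->|/cos_inj E]; first by apply: eq_col2; rewrite ?polar0E ?polar1E !mul0r.
by congr polar; apply: (mulfI (lt0r_neq0 m0)); apply: E; exact: mtheta.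
Qed.

Lemma orbit_representativeE x y :
  linear_orbit (I2 R m) x y -> I2_domain R m y ->
  orbit_representative (I2 R m) (I2_domain R m) x = y.
Proof.
move=> xy Dy; apply: xget_unique => // z [[h Ih <-] Dz].
case: xy Dy => [g Ig <-] Dy; apply: I2_domain_uniq => //.
apply: (@same_invariants_trans _ x); last exact: I2_same_invariants.
exact/same_invariants_sym/I2_same_invariants.
Qed.

End DihedralGroup.

(** * Segments joining points to their mirror images *)

Section Mirror.
Variable R : realType.
Implicit Types (r s theta tau phi : R) (x y z : 'cV[R]_2) (Q K : set 'cV[R]_2).

Definition mirror phi Q : set 'cV[R]_2 :=
  reflection_relation (line_normal phi)^T (line_normal phi) Q.

Lemma ev_line_normal phi x : ev (line_normal phi)^T x = line_form phi x.
Proof.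
rewrite /ev mxE big_ord_recl big_ord1 (_ : lift ord0 ord0 = 1); last exact: val_inj.
by rewrite !mxE /= /line_form; ring.
Qed.

Lemma mirror_id phi Q x : Q x -> halfplane phi x -> mirror phi Q x.
Proof.
move=> Qx hx; exists x, 0; split; rewrite ?scale0r ?addr0// ev_line_normal.
by rewrite oppr_ge0 pmulr_rle0.
Qed.

Lemma line_form_reflection phi x :
  line_form phi (reflection phi *m x) = - line_form phi x.
Proof.
have [r [theta [_ ->]]] := polarP x.
rewrite reflection_polar !line_form_polar -mulrN -sinN; congr (_ * sin _).
by rewrite mulr2n; ring.
Qed.

Lemma mirror_reflection phi Q x :
  Q (reflection phi *m x) -> 0 <= line_form phi x -> mirror phi Q x.
Proof.
(* The point is the far end of the segment that starts at its mirror image. *)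
move=> Qx hx; exists (reflection phi *m x), (2 * line_form phi x).
rewrite ev_line_normal line_form_reflection mulrN opprK; split=> //.
  exact: mulr_ge0.
by rewrite reflectionE subrK.
Qed.

Lemma mirror_sub phi Q K : convex_set K ->
  (forall x, K x -> K (reflection phi *m x)) -> Q `<=` K -> mirror phi Q `<=` K.
Proof.
move=> /convex_setP cK Kphi QK _ [x [t [/QK Kx t0 + ->]]].
(* [d] is the length of the segment from [x] to its mirror image, so [t / d] is the convex weight;
   [d = 0] is split off before dividing. *)
rewrite ev_line_normal => tx; set d := - (2 * line_form phi x) in tx.
have [d0|d0] := eqVneq d 0.
  have -> : t = 0 by apply/eqP; rewrite eq_le t0 -d0 tx.
  by rewrite scale0r addr0.
have {}d0 : 0 < d by rewrite lt_def d0 (le_trans t0).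
have -> : x + t *: line_normal phi =
    t / d *: (reflection phi *m x) + (1 - t / d) *: x.
  rewrite reflectionE -scaleNr -/d scalerDr scalerA divfK ?gt_eqF//.
  by rewrite addrAC -scalerDl [_ + (1 - _)]addrC subrK scale1r.
apply: cK; [exact: Kphi|exact: Kx| |]; first exact: divr_ge0 (ltW d0).
by rewrite ler_pdivrMr// mul1r.
Qed.

Lemma extended_formulation_mirror phi Q d f :
  has_extended_formulation Q d f ->
  has_extended_formulation (mirror phi Q) (d + 1) (f + 2).
Proof. exact: extended_formulation_reflection_relation. Qed.

End Mirror.

(** * Iterated mirrors at the doubled angles *)

Section Unfolding.
Variables (R : realType) (m : nat).
Hypothesis m_gt0 : (0 < m)%N.
Variable P : set 'cV[R]_2.

Fixpoint unfolding (k : nat) : set 'cV[R]_2 :=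
  if k is k'.+1 then mirror (fold_angle R m k') (unfolding k') else P.

Lemma extended_formulation_unfolding (n f k : nat) :
  has_extended_formulation P n f ->
  has_extended_formulation (unfolding k) (n + k) (f + 2 * k).
Proof.
move=> efP; elim: k => [|k IHk]; first by rewrite muln0 !addn0.
have -> : (n + k.+1 = n + k + 1)%N by rewrite addn1 addnS.
have -> : (f + 2 * k.+1 = f + 2 * k + 2)%N by rewrite mulnS addnA addnAC.
exact: extended_formulation_mirror.
Qed.

(* Folding at the angle phi fixes [0, phi] pointwise only when phi <= pi, whence
   the bound fold_angle k <= 2 pi. *)
Lemma unfolding_polar (k : nat) (r theta : R) :
  0 <= r -> 0 <= theta -> theta <= pi -> theta <= fold_angle R m k ->
  fold_angle R m k <= pi *+ 2 ->
  (forall y, linear_orbit (I2 R m) (polar r theta) y -> I2_domain R m y -> P y) ->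
  unfolding k (polar r theta).
Proof.
have m0 : 0 < m%:R :> R by rewrite ltr0n.
move=> r0; elim: k theta => [|k IHk] theta theta0 theta_pi theta_k k_pi hP.
  apply: hP; first by exists 1%:M; [exact: I2_1|rewrite mul1mx].
  split; first by rewrite /= polar1E mulr_ge0// sin_ge0_pi// theta0.
  rewrite /halfplane /= line_form_polar mulr_ge0_le0//.
  rewrite -oppr_ge0 -sinN opprB sin_ge0_pi// subr_ge0.
  rewrite /fold_angle mul1r in theta_k; rewrite theta_k lerBlDr.
  apply: (@le_trans _ _ pi); last by rewrite lerDl.
  by rewrite ler_pdivrMr// ler_peMr ?pi_ge0// ler1n.
have phi0 : 0 < fold_angle R m k by rewrite mulr_gt0 ?exprn_gt0// divr_gt0 ?pi_gt0.
have phiS : fold_angle R m k.+1 = fold_angle R m k *+ 2.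
  by rewrite /fold_angle exprS mulr2n; ring.
(* Halving the bound [2 phi <= 2 pi] leaves [phi <= pi]. *)
rewrite phiS {phiS} lerMn2r/= in theta_k k_pi *; rewrite /=.
have := @I2_fold_angle R m k; move: (fold_angle R m k) => phi in phi0 theta_k k_pi IHk * => Iphi.
have [theta_phi|/ltW phi_theta] := leP theta phi.
  apply: mirror_id; last first.
    rewrite /halfplane /= line_form_polar mulr_ge0_le0//.
    by rewrite -oppr_ge0 -sinN opprB sin_ge0_pi// subr_ge0 theta_phi lerBlDr ler_wpDr.
  by apply: IHk => //; rewrite (le_trans k_pi)// mulr2n lerDl pi_ge0.
apply: mirror_reflection; last first.
  rewrite line_form_polar mulr_ge0// sin_ge0_pi// subr_ge0 phi_theta.
  by rewrite lerBlDr ler_wpDr// ltW.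
(* As [phi <= theta <= 2 phi], the reflected angle [2 phi - theta] lies in [[0, phi]], and the
   reflected point has its orbit inside that of the original. *)
rewrite reflection_polar; apply: IHk.
- by rewrite subr_ge0.
- by rewrite mulr2n lerBlDr lerD// (le_trans phi_theta).
- by rewrite mulr2n lerBlDr lerD2l.
- by rewrite (le_trans k_pi)// mulr2n lerDl pi_ge0.
move=> y [g Ig <-]; apply: hP; rewrite -reflection_polar.
by exists (g *m reflection phi); [exact: I2_mul|rewrite mulmxA].
Qed.

End Unfolding.

(** * The power of two lies between [m] and [2 m] *)

Section CeilLog2.
Variables (R : realType) (m : nat).
Hypothesis m_gt0 : (0 < m)%N.

Let ln2_gt0 : 0 < ln (2 : R).
Proof. by rewrite ln_gt0// ltr1n. Qed.

Let m0 : 0 < m%:R :> R.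
Proof. by rewrite ltr0n. Qed.

Let ceil_log2E : (ceil_log2 R m)%:R = (Num.ceil (ln (m%:R : R) / ln 2))%:~R :> R.
Proof.
rewrite /ceil_log2 natr_absz ger0_norm// ceil_ge0.
by apply: lt_le_trans (ltrN10 _) (divr_ge0 (ln_ge0 _) (ltW ln2_gt0)); rewrite ler1n.
Qed.

(** Rounding the logarithm up; this makes the last sector, of angle [2^r pi / m], cover the upper
    half plane. *)
Lemma le_ceil_log2 : m%:R <= 2 ^+ ceil_log2 R m :> R.
Proof.
rewrite -ler_ln ?posrE ?exprn_gt0// lnXn// -[_ *+ ceil_log2 R m]mulr_natl ceil_log2E.
by rewrite -ler_pdivrMr// ceil_ge.
Qed.

(** Rounding up adds less than 1 to the logarithm; this keeps the last sector angle below [2 pi]. *)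
Lemma ceil_log2_lt : 2 ^+ ceil_log2 R m < 2 * m%:R :> R.
Proof.
rewrite -ltr_ln ?posrE ?exprn_gt0 ?mulr_gt0// lnXn// lnM ?posrE//.
rewrite -[_ *+ ceil_log2 R m]mulr_natl ceil_log2E -ltr_pdivlMr// mulrDl divff ?gt_eqF//.
by rewrite addrC -ltrBlDr -[X in _ - X]/(1%:~R) -rmorphB ceilB1_lt.
Qed.

End CeilLog2.

(** * The symmetrized hull equals the final mirror set *)

Theorem theorem3 (R : realType) (m : nat) (m_gt0 : (0 < m)%N)
    (P : set 'cV[R]_2) (n' f' : nat) :
  polytope P ->
  (forall v, vertex P v ->
     P (orbit_representative (I2 R m) (I2_domain R m) v)) ->
  has_extended_formulation P n' f' ->
  has_extended_formulation (symmetrized_hull (I2 R m) P)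
    (n' + ceil_log2 R m + 1)%N (f' + 2 * ceil_log2 R m + 2)%N.
Proof.
move=> Ppoly Prepr efP; pose r := ceil_log2 R m.
have m0 : 0 < m%:R :> R by rewrite ltr0n.
have := extended_formulation_mirror pi (extended_formulation_unfolding m r efP).
set Q := mirror pi _ => efQ.
suff -> : symmetrized_hull (I2 R m) P = Q by [].
have hull_conv : convex_set (symmetrized_hull (I2 R m) P) by exact: convex_conv_hull.
(* The hull is invariant: its preimage under [g] is convex and contains all the generating images
   [h P]. *)
have hull_I2 g x : I2 R m g -> symmetrized_hull (I2 R m) P x ->
    symmetrized_hull (I2 R m) P (g *m x).
  move=> Ig; apply: (conv_hull_min (B := mulmx g @^-1` symmetrized_hull (I2 R m) P)).
    exact: convex_preimage.
  move=> _ [h Ih [y Py <-]] /=; apply: sub_conv_hull.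
  by exists (g *m h); [exact: I2_mul|exists y; rewrite ?mulmxA].
have fold_pi : pi <= fold_angle R m r.
  by rewrite /fold_angle mulrCA ler_peMr ?pi_ge0// ler_pdivlMr// mul1r le_ceil_log2.
have fold_2pi : fold_angle R m r <= pi *+ 2.
  rewrite /fold_angle mulrCA -[pi *+ 2]mulr_natr ler_pM2l ?pi_gt0// ler_pdivrMr//.
  exact/ltW/ceil_log2_lt.
apply/seteqP; split.
  apply: conv_hull_min; first exact: convex_extended_formulation efQ.
  move=> _ [g Ig [x /(polytope_sub_conv_vertices Ppoly) + <-]] /=.
  (* By convexity of [Q] only images [g v] of vertices remain to be checked. *)
  apply: (conv_hull_min (B := mulmx g @^-1` Q)).
    exact/convex_preimage/(convex_extended_formulation efQ).
  move=> v Pv /=.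
  have upper h : I2 R m h -> 0 <= (h *m v) 1 0 -> unfolding m P r (h *m v).
    move=> Ih /polar_upper_halfplane[s [theta [s0 theta0 theta_pi hE]]].
    rewrite hE; apply: unfolding_polar => //; first exact: le_trans fold_pi.
    rewrite -hE => _ [k Ik <-] Dk; rewrite mulmxA in Dk *.
    (* A domain point in the orbit of [h v] is the representative of [v], which lies in [P] by
       hypothesis. *)
    rewrite -(orbit_representativeE m_gt0 (x := v) _ Dk); first exact: Prepr.
    by exists (k *m h) => //; exact: I2_mul.
  have form_pi y : line_form pi y = - y 1 0.
    by rewrite /line_form sinpi cospi mulr0 add0r mulrN1.
  have [gv|gv] := leP 0 ((g *m v) 1 0).
    by apply: mirror_id; [exact: upper|rewrite /halfplane /= form_pi oppr_le0].
  have gv' : 0 <= line_form pi (g *m v) by rewrite form_pi oppr_ge0 ltW.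
  apply: mirror_reflection => //; rewrite mulmxA; apply: upper.
    by apply: I2_mul => //; exact: I2_reflection_pi.
  by rewrite -mulmxA -oppr_le0 -form_pi line_form_reflection oppr_le0.
(* Conversely, each mirror step stays inside the convex invariant hull. *)
apply: mirror_sub => //; first by move=> x; apply: hull_I2; exact: I2_reflection_pi.
elim: r {efQ Q fold_pi fold_2pi} => [|k IHk] /=.
  by move=> x Px; apply: sub_conv_hull; exists 1%:M; [exact: I2_1|exists x; rewrite ?mul1mx].
by apply: mirror_sub => // x; apply: hull_I2; exact: I2_fold_angle.
Qed.
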